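(* Let $\mathbb{F}$ be a field with $\operatorname{char}(\mathbb{F})\neq 2$, and let $\mathbf{a}=(a_1,a_2,\dots)$ be a sequence of non-zero elements of $\mathbb{F}$. For each $n$, let $T$ be a uniformly random tournament on $[n]=\{1,\dots,n\}$ (each edge $\{i,j\}$ oriented in either direction with probability $1/2$, independently over edges), and let $M_T(\mathbf{a})$ be the $n\times n$ symmetric matrix over $\mathbb{F}$ with all diagonal entries zero and, for $1\le i<j\le n$, $M_T(\mathbf{a})(i,j)=M_T(\mathbf{a})(j,i)=a_i$ if $i\to j$ in $T$ and $=a_j$ if $j\to i$ in $T$. Then \[ \mathbb{P}\Bigl(\operatorname{rank}(M_T(\mathbf{a}))\ \ge\ \tfrac{n}{2}-21\sqrt{n\log n}\Bigr)\ \to\ 1 \quad\text{as } n\to\infty, \] where rank is taken over $\mathbb{F}$.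
   Context: A tournament on $[n]$ is an orientation of the complete graph on $[n]$: for each pair $i\neq j$ exactly one of $i\to j$, $j\to i$ holds. Only the first $n$ terms $a_1,\dots,a_n$ of $\mathbf{a}$ are used to form $M_T(\mathbf{a})$; the randomness is only over the tournament $T$. *)

(* Defs.v *)
From HB Require Import structures.
From mathcomp Require Import all_boot all_order all_algebra.
From mathcomp Require Import all_classical all_reals all_analysis.

Set Implicit Arguments.
Unset Strict Implicit.
Unset Printing Implicit Defensive.

Import Order.TTheory GRing.Theory Num.Theory.
Import numFieldNormedType.Exports.

Local Open Scope ring_scope.

(* The vertex set [n] is ['I_n] = {0, ..., n-1}.  A digraph is given by its set
   of arcs, where [(i, j) \in T] means i -> j. *)
Definition is_tournament (n : nat) (T : {set 'I_n * 'I_n}) : bool :=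
  [forall i, (i, i) \notin T] &&
  [forall i, forall j, (i != j) ==> (((i, j) \in T) (+) ((j, i) \in T))].

Definition tournament (n : nat) : finType :=
  {T : {set 'I_n * 'I_n} | is_tournament T}.

Definition arc (n : nat) (T : tournament n) (i j : 'I_n) : bool :=
  (i, j) \in val T.

(* Uniform distribution on tournaments; orienting the edges by independent fair
   coins gives the same distribution. *)
Definition tournament_prob (R : realType) (n : nat) (E : pred (tournament n)) : R :=
  #|E|%:R / #|tournament n|%:R.

(* Sequences are indexed from 0: [a i] is the term attached to vertex [i]. *)
Definition tournament_matrix (F : fieldType) (n : nat) (a : nat -> F)
    (T : tournament n) : 'M[F]_n :=
  \matrix_(i, j)
    if (i < j)%N then (if arc T i j then a i else a j)
    else if (j < i)%N then (if arc T j i then a j else a i)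
    else 0.

(* Main.v *)
(* Let m = floor(n/2).  If some value occurs more than m times in a, the
   corresponding principal submatrix is c(J - I), of rank at least m.  Otherwise
   list the vertices as s_0, ..., s_{n-1} with equal values of a consecutive;
   then a(s_i) <> a(s_{m+j}) whenever i <= j, so the m x m submatrix with rows
   s_0, ..., s_{m-1} and columns s_m, ..., s_{2m-1} has independent entries,
   those on or above the diagonal taking two distinct values with probability
   1/2 each.
   Exposing its rows from the bottom up, Odlyzko's bound gives
   E[2^corank] <= 1 + m/2, and Markov's inequality shows that the corank is
   below 2 log_2 n with probability 1 - O(1/n). *)
Require Import Defs.
From HB Require Import structures.
From mathcomp Require Import all_boot all_order all_algebra.
From mathcomp Require Import all_classical all_reals all_analysis.
From mathcomp Require Import zify lra.

Set Implicit Arguments.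
Unset Strict Implicit.
Unset Printing Implicit Defensive.

Import Order.TTheory GRing.Theory Num.Theory.
Import numFieldNormedType.Exports.

Local Open Scope ring_scope.

(** * Corank of matrices with independent two-valued entries *)

Lemma mxrank_mxsub_le (F : fieldType) (m n p q : nat) (f : 'I_p -> 'I_m)
    (g : 'I_q -> 'I_n) (A : 'M[F]_(m, n)) :
  (\rank (mxsub f g A) <= \rank A)%N.
Proof.
rewrite mxsubrc (leq_trans (mxrankS (rowsub_sub _ _))) //.
rewrite -mxrank_tr trmx_mxsub (leq_trans (mxrankS (rowsub_sub _ _))) //.
by rewrite mxrank_tr.
Qed.

(** The coins [b] are kept apart from the two candidate values of each entry, so that expectations
    become sums over Boolean matrices. *)
Definition select_mx (F : Type) (m n : nat) (u v : 'M[F]_(m, n))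
    (b : 'M[bool]_(m, n)) : 'M[F]_(m, n) :=
  \matrix_(i, j) if b i j then u i j else v i j.

Lemma select_col_mx (F : Type) (m1 m2 n : nat) (u v : 'M[F]_(m1 + m2, n))
    (b1 : 'M[bool]_(m1, n)) (b2 : 'M[bool]_(m2, n)) :
  select_mx u v (col_mx b1 b2) =
    col_mx (select_mx (usubmx u) (usubmx v) b1)
           (select_mx (dsubmx u) (dsubmx v) b2).
Proof.
apply/matrixP => i j; case: (split_ordP i) => k ->.
  rewrite col_mxEu !mxE; case: split_ordP => l /eqP.
    by rewrite eq_lshift => /eqP <-.
  by rewrite eq_lrshift.
rewrite col_mxEd !mxE; case: split_ordP => l /eqP; first by rewrite eq_rlshift.
by rewrite eq_rshift => /eqP <-.
Qed.

Lemma select_row_mx (F : Type) (m n1 n2 : nat) (u v : 'M[F]_(m, n1 + n2))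
    (b1 : 'M[bool]_(m, n1)) (b2 : 'M[bool]_(m, n2)) :
  select_mx u v (row_mx b1 b2) =
    row_mx (select_mx (lsubmx u) (lsubmx v) b1)
           (select_mx (rsubmx u) (rsubmx v) b2).
Proof.
apply/matrixP => i j; case: (split_ordP j) => k ->.
  rewrite row_mxEl !mxE; case: split_ordP => l /eqP.
    by rewrite eq_lshift => /eqP <-.
  by rewrite eq_lrshift.
rewrite row_mxEr !mxE; case: split_ordP => l /eqP; first by rewrite eq_rlshift.
by rewrite eq_rshift => /eqP <-.
Qed.

(* Odlyzko's argument: a vector of a d-dimensional row space is determined by
   d suitable coordinates. *)
Lemma card_select_submx (F : fieldType) (m n : nat) (u v : 'rV[F]_n)
    (B : 'M[F]_(m, n)) (uv : forall j, u 0 j != v 0 j) :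
  (#|[set b : 'rV[bool]_n | (select_mx u v b <= B)%MS]| <= 2 ^ \rank B)%N.
Proof.
rewrite -mxrank_tr; set f := maxrankfun B^T.
have [C BE] : exists C, B = colsub f B *m C.
  have /submxP[C /(congr1 trmx)] : (B^T <= rowsub f B^T)%MS.
    by rewrite eq_maxrowsub.
  by rewrite trmx_mul trmx_mxsub !trmxK => BE; exists C^T.
rewrite -[X in (_ <= 2 ^ X)%N]mul1n -card_bool -card_mx.
rewrite -(@card_in_imset _ _ (fun b : 'rV[bool]_n => colsub f b)).
  exact: max_card.
move=> b b'; rewrite !inE => /submxP[y yE] /submxP[y' yE'] bb'.
have : colsub f (select_mx u v b) = colsub f (select_mx u v b').
  apply/rowP => j; rewrite !mxE.
  by have /rowP/(_ j) := bb'; rewrite !mxE => ->.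
rewrite yE yE' -!mulmx_colsub => /(congr1 (mulmx^~ C)).
rewrite -!mulmxA -BE -yE -yE' => /rowP E; apply/rowP => j.
have := E j; rewrite !mxE; case: (b 0 j); case: (b' 0 j) => // /eqP.
  by rewrite (negPf (uv j)).
by rewrite eq_sym (negPf (uv j)).
Qed.

(** A new row outside the span of [B] leaves the corank unchanged; one inside raises it by 1 and so
    adds a further [2 ^ (n - \rank B)]. At most [2 ^ \rank B] rows are of the second kind, so the
    total excess is at most [2 ^ n]. *)
Lemma sum_expn_corank_col_mx (F : fieldType) (n : nat) (u v : 'rV[F]_n.+1)
    (B : 'M[F]_(n, n.+1)) (uv : forall j, u 0 j != v 0 j) :
  (\sum_(r : 'rV[bool]_n.+1) 2 ^ (n.+1 - \rank (col_mx (select_mx u v r) B))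
     <= 2 ^ n.+1 * 2 ^ (n - \rank B) + 2 ^ n)%N.
Proof.
set S := [set b : 'rV[bool]_n.+1 | (select_mx u v b <= B)%MS].
have rB : (\rank B <= n)%N by apply: rank_leq_row.
rewrite (@leq_trans (\sum_(r : 'rV[bool]_n.+1)
    (2 ^ (n - \rank B) + (r \in S) * 2 ^ (n - \rank B)))%N) //.
  apply: leq_sum => r _; rewrite inE -addsmxE.
  case: (boolP (_ <= _)%MS) => [rb|rb].
    rewrite (addsmx_idPr rb) mul1n addnn -mul2n -expnS leq_exp2l //; lia.
  rewrite mul0n addn0 leq_exp2l //.
  have : (\rank B < \rank (select_mx u v r + B)%MS)%N.
    rewrite ltn_neqAle mxrankS ?addsmxSr // andbT; apply: contra rb.
    by rewrite mxrank_leqif_sup ?addsmxSr // addsmx_sub => /andP[].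
  lia.
rewrite big_split /= sum_nat_const card_mx card_bool mul1n leq_add2l.
have SE : (\sum_(r : 'rV[bool]_n.+1) (r \in S) = #|S|)%N.
  rewrite -sum1_card [RHS]big_mkcond; apply: eq_bigr => r _.
  by case: (r \in S).
rewrite -big_distrl SE /= -[X in (_ <= 2 ^ X)%N](subnKC rB) expnD.
by rewrite leq_pmul2r ?expn_gt0 // card_select_submx.
Qed.

Lemma sum_block_mx (T : finType) (n : nat) (f : 'M[T]_n.+1 -> nat) :
  (\sum_(b : 'M[T]_n.+1) f b =
   \sum_(c : 'cV[T]_n) \sum_(b : 'M[T]_n) \sum_(r : 'rV[T]_n.+1)
      f (col_mx r (row_mx c b : 'M[T]_(n, 1 + n))))%N.
Proof.
rewrite pair_bigA pair_bigA /=.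
rewrite (reindex (fun p : ('cV[T]_n * 'M[T]_n) * 'rV[T]_n.+1 =>
   col_mx p.2 (row_mx p.1.1 p.1.2 : 'M[T]_(n, 1 + n)) : 'M[T]_(1 + n))) //.
exists (fun b : 'M[T]_(1 + n) =>
   ((lsubmx (dsubmx b), rsubmx (dsubmx b)), usubmx b)) => [[[c b] r]|b] _ /=.
  by rewrite col_mxKd row_mxKl row_mxKr col_mxKu.
by rewrite hsubmxK vsubmxK.
Qed.

(* With [D] the corank of the rows already exposed, the next row lies in their
   span with probability at most [2 ^ - (D + 1)], so the expectation of [2 ^ D]
   increases by at most 1/2 per row.  Rows are exposed from the bottom up, which
   lets the entries below the diagonal be constant. *)
Lemma sum_expn_corank_select (F : fieldType) (n : nat) (u v : 'M[F]_n)
    (uv : forall i j : 'I_n, (i <= j)%N -> u i j != v i j) :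
  (2 * \sum_(b : 'M[bool]_n) 2 ^ (n - \rank (select_mx u v b))
     <= n.+2 * 2 ^ (n * n))%N.
Proof.
elim: n u v uv => [|n IHn] u v uv.
  rewrite muln0 muln1 (eq_bigr (fun _ => 1%N)) //.
  by rewrite sum_nat_const card_mx card_bool !muln0.
rewrite (sum_block_mx (fun b => 2 ^ (n.+1 - \rank (select_mx u v b)))%N).
pose u' : 'M[F]_(1 + n, 1 + n) := u; pose v' : 'M[F]_(1 + n, 1 + n) := v.
set u2 := rsubmx (dsubmx u'); set v2 := rsubmx (dsubmx v').
have uv2 (i j : 'I_n) : (i <= j)%N -> u2 i j != v2 i j.
  by move=> ij; rewrite !mxE uv.
have uv1 (j : 'I_n.+1) : usubmx u' 0 j != usubmx v' 0 j.
  by rewrite !mxE uv.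
have {}IHn := IHn _ _ uv2.
set S := (\sum_b _)%N in IHn.
apply: (@leq_trans (2 * \sum_(c : 'cV[bool]_n) \sum_(b : 'M[bool]_n)
   (2 ^ n.+1 * 2 ^ (n - \rank (select_mx u2 v2 b)) + 2 ^ n))%N).
  rewrite leq_mul2l /=; apply: leq_sum => c _; apply: leq_sum => b _.
  set B := select_mx (dsubmx u') (dsubmx v') (row_mx c b).
  (* Dropping the first column, whose entries [c] lie below the diagonal, can only lower the rank;
     the induction hypothesis then handles the remaining square block. *)
  have BE : (\rank (select_mx u2 v2 b) <= \rank B)%N.
    rewrite /B (@select_row_mx _ n 1 n) -[X in (X <= _)%N]mxrank_tr.
    by rewrite -[X in (_ <= X)%N]mxrank_tr tr_row_mx -addsmxE mxrankS ?addsmxSr.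
  rewrite (eq_bigr (fun r => 2 ^ (n.+1 - \rank (col_mx
    (select_mx (usubmx u') (usubmx v') r) B)))%N); last first.
    by move=> r _; rewrite (@select_col_mx _ 1 n n.+1 u' v').
  apply: leq_trans (sum_expn_corank_col_mx _ uv1) _.
  by rewrite leq_add2r leq_mul2l leq_exp2l // leq_sub2l ?orbT.
rewrite sum_nat_const big_split /= -big_distrr /= -/S sum_nat_const.
rewrite !card_mx card_bool muln1.
have -> : (2 ^ (n.+1 * n.+1) = 2 ^ n * 2 ^ n.+1 * 2 ^ (n * n))%N.
  by rewrite -!expnD; congr (_ ^ _)%N; lia.
rewrite expnS in IHn *; nia.
Qed.

(** * Sorting the vertices, and the case of a frequent value *)

Lemma exists_sorting (n : nat) (key : 'I_n -> nat) :
  exists2 s : 'I_n -> 'I_n, injective s &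
    forall i j : 'I_n, (i <= j)%N -> (key (s i) <= key (s j))%N.
Proof.
set l := sort (relpre key leq) (enum 'I_n).
have szl : size l = n by rewrite size_sort size_enum_ord.
exists (fun i : 'I_n => nth i l i) => [i j ij|i j ij].
  rewrite (set_nth_default i) ?szl // in ij; apply/val_inj/eqP.
  rewrite -(nth_uniq i _ _ (s := l)) ?szl ?ltn_ord ?ij //.
  by rewrite sort_uniq enum_uniq.
rewrite (set_nth_default i j) ?szl //.
have lesym : transitive (relpre key leq) by move=> ? ? ? /=; apply: leq_trans.
apply: (sorted_leq_nth lesym) => //; rewrite ?inE ?szl //.
  by move=> ? /=.
by apply: sort_sorted => ? ? /=; apply: leq_total.
Qed.

(** The invertible matrix [c%:M] is the difference of [const_mx c], of rank at most 1, and this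
    matrix; rank is subadditive. *)
Lemma mxrank_const_sub_scalar (F : fieldType) (n : nat) (c : F) :
  c != 0 -> (n <= \rank (const_mx c - c%:M : 'M[F]_n.+1)%R)%N.
Proof.
move=> c0; set A := (_ - _)%R.
have : (\rank (c%:M : 'M[F]_n.+1) <= \rank (const_mx c - A)%R)%N.
  by rewrite /A opprB addrC subrK.
rewrite -scalemx1 mxrank_scale_nz // mxrank1.
move=> /leq_trans/(_ (mxrank_add _ _)); rewrite eqmx_opp => h.
suff : (\rank (const_mx c : 'M[F]_n.+1) <= 1)%N by lia.
have -> : const_mx c = (const_mx c : 'cV[F]_n.+1) *m (const_mx 1 : 'rV_n.+1).
  by apply/matrixP => i j; rewrite !mxE big_ord1 !mxE mulr1.
by rewrite (leq_trans (mxrankM_maxl _ _)) ?rank_leq_col.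
Qed.

Lemma rank_tournament_mx_constant (F : fieldType) (n m : nat) (a : nat -> F)
    (T : tournament n) (f : 'I_m.+1 -> 'I_n) (c : F) :
  injective f -> c != 0 -> (forall i, a (f i) = c) ->
  (m <= \rank (tournament_matrix a T))%N.
Proof.
move=> f_inj c0 ac; apply: leq_trans (mxrank_mxsub_le f f _).
have -> : mxsub f f (tournament_matrix a T) = const_mx c - c%:M.
  apply/matrixP => i j; rewrite !mxE !ac !if_same.
  case: ltngtP => [fij|fij|/val_inj/f_inj ->]; last by rewrite eqxx subrr.
    by case: eqP => [ij|_]; [rewrite ij ltnn in fij | rewrite subr0].
  by case: eqP => [ij|_]; [rewrite ij ltnn in fij | rewrite subr0].
exact: mxrank_const_sub_scalar.
Qed.

(** * Reversing a prescribed set of edges *)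

Definition flipped (n : nat) (e : rel 'I_n) (i j : 'I_n) : bool :=
  (i != j) && (e i j || e j i).

(** [flipped e] is symmetric and irreflexive for every [e]: both arcs between two vertices change
    together and no loop appears. *)
Lemma flip_subproof (n : nat) (e : rel 'I_n) (T : tournament n) :
  is_tournament [set p | (p \in val T) (+) flipped e p.1 p.2].
Proof.
have /andP[/forallP Tirr /forallP Ttot] := valP T; apply/andP; split.
  by apply/forallP => i; rewrite inE /flipped eqxx addbF Tirr.
apply/forallP => i; apply/forallP => j; apply/implyP => ij; rewrite !inE /=.
have /forallP/(_ j)/implyP/(_ ij) := Ttot i.
rewrite /flipped (eq_sym j) ij (orbC (e j i)) /=.
by case: (_ \in _); case: (_ \in _); case: (_ || _).
Qed.

Definition flip (n : nat) (e : rel 'I_n) (T : tournament n) : tournament n :=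
  Sub _ (flip_subproof e T).

Lemma arc_flip (n : nat) (e : rel 'I_n) (T : tournament n) (i j : 'I_n) :
  Defs.arc (flip e T) i j = Defs.arc T i j (+) flipped e i j.
Proof. by rewrite /Defs.arc inE. Qed.

Lemma flipK (n : nat) (e : rel 'I_n) : involutive (flip e).
Proof.
move=> T; apply/val_inj/setP => -[i j].
have : Defs.arc (flip e (flip e T)) i j = Defs.arc T i j.
  by rewrite !arc_flip addbK.
by [].
Qed.

Definition block_rel (n m : nat) (x y : 'I_m -> 'I_n) (d : 'M[bool]_m) :
    rel 'I_n :=
  fun p q => [exists i, exists j, [&& d i j, p == x i & q == y j]].

Lemma flipped_block (n m : nat) (x y : 'I_m -> 'I_n) (x_inj : injective x)
    (y_inj : injective y) (xy : forall i j, x i != y j) (d : 'M[bool]_m)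
    (i j : 'I_m) :
  flipped (block_rel x y d) (x i) (y j) = d i j.
Proof.
rewrite /flipped xy /=; apply/idP/idP => [|dij].
  case/orP => /existsP[i' /existsP[j' /and3P[dij]]].
    by move=> /eqP/x_inj -> /eqP/y_inj ->.
  by rewrite eq_sym (negPf (xy _ _)).
apply/orP; left; apply/existsP; exists i; apply/existsP; exists j.
by rewrite dij !eqxx.
Qed.

(** The ranges of [x] and [y] are disjoint, so distinct pairs [(i, j)] give distinct edges, and coin
    [d i j] alone swaps the entry between [a (x i)] and [a (y j)]. *)
Lemma tournament_mx_flip_block (F : fieldType) (a : nat -> F) (n m : nat)
    (x y : 'I_m -> 'I_n) (x_inj : injective x) (y_inj : injective y)
    (xy : forall i j, x i != y j) (T : tournament n) :
  exists u v : 'M[F]_m,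
    (forall i j, a (x i) != a (y j) -> u i j != v i j) /\
    forall d, mxsub x y (tournament_matrix a (flip (block_rel x y d) T))
      = select_mx u v d.
Proof.
(* [t i j] says that [T] orients the edge from [x i] to [y j]; the two cases follow the matrix,
   which reads the arc leaving the smaller vertex. *)
pose t i j :=
  if (x i < y j)%N then Defs.arc T (x i) (y j) else ~~ Defs.arc T (y j) (x i).
exists (\matrix_(i, j) if t i j then a (y j) else a (x i)).
exists (\matrix_(i, j) if t i j then a (x i) else a (y j)).
split=> [i j aij|d]; first by rewrite !mxE; case: ifP => // _; rewrite eq_sym.
apply/matrixP => i j; rewrite !mxE !arc_flip /t flipped_block //.
have -> : flipped (block_rel x y d) (y j) (x i) = d i j.
  by rewrite -(flipped_block x_inj y_inj xy d) /flipped eq_sym orbC.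
case: ltngtP => [_|_|/val_inj/eqP]; last by rewrite (negPf (xy i j)).
  by case: (Defs.arc _ _ _); case: (d i j).
by case: (Defs.arc _ _ _); case: (d i j).
Qed.

(* Re-randomising the edges between [x] and [y] preserves the uniform
   distribution on tournaments. *)
Lemma sum_expn_corank_tournament (F : fieldType) (a : nat -> F) (n m : nat)
    (x y : 'I_m -> 'I_n) (x_inj : injective x) (y_inj : injective y)
    (xy : forall i j, x i != y j)
    (axy : forall i j : 'I_m, (i <= j)%N -> a (x i) != a (y j)) :
  (2 * \sum_(T : tournament n) 2 ^ (m - \rank (tournament_matrix a T))
     <= m.+2 * #|tournament n|)%N.
Proof.
rewrite -(@leq_pmul2r (2 ^ (m * m))) ?expn_gt0 // -mulnA.
set S := (\sum_T _)%N.
have SE : (S * 2 ^ (m * m) = \sum_(T : tournament n) \sum_(d : 'M[bool]_m)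
    2 ^ (m - \rank (tournament_matrix a (flip (block_rel x y d) T))))%N.
  rewrite exchange_big /= mulnC.
  transitivity (\sum_(d : 'M[bool]_m) S)%N.
    by rewrite sum_nat_const card_mx card_bool.
  apply: eq_bigr => d _; rewrite /S.
  by rewrite (reindex_inj (inv_inj (@flipK n (block_rel x y d)))).
rewrite SE big_distrr /= mulnAC [X in (_ <= X)%N]mulnC -sum_nat_const.
apply: leq_sum => T _.
have [u [v [uv selE]]] := tournament_mx_flip_block a x_inj y_inj xy T.
apply: leq_trans (sum_expn_corank_select (u := u) (v := v) _); last first.
  by move=> i j ij; rewrite uv ?axy.
rewrite leq_mul2l /=; apply: leq_sum => d _.
by rewrite leq_exp2l // leq_sub2l // -selE mxrank_mxsub_le.
Qed.

(** * Counting tournaments of low rank *)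

Lemma card_low_rank_tournament (F : fieldType) (a : nat -> F)
    (a_neq0 : forall i, a i != 0) (n k : nat) (k_gt0 : (0 < k)%N) :
  (2 * (#|[pred T : tournament n |
            (\rank (tournament_matrix a T) + k <= n./2)%N]| * 2 ^ k)
     <= n./2.+2 * #|tournament n|)%N.
Proof.
set m := n./2; have mn : (m + m <= n)%N by rewrite /m; lia.
(* [F] carries no order, so values are ranked by their first occurrence; sorting by this key makes
   equal values consecutive. *)
pose key (i : 'I_n) := index (a i) [seq a j | j <- iota 0 n].
have key_inj i j : key i = key j -> a i = a j.
  have inl (l : 'I_n) : a l \in [seq a j | j <- iota 0 n].
    by rewrite map_f // mem_iota /=.
  by move=> ij; rewrite -(nth_index 0 (inl i)) -/(key i) ij nth_index.
have [s s_inj s_mono] := exists_sorting key.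
have ltx (i : 'I_m) : (i < n)%N by have := ltn_ord i; lia.
have lty (i : 'I_m) : (m + i < n)%N by have := ltn_ord i; lia.
pose x i := s (Ordinal (ltx i)); pose y i := s (Ordinal (lty i)).
(* If sorted positions [i] and [m + j] share a key with [i <= j], monotonicity gives the same value
   to the [m + 1] positions [i, ..., i + m], and then no tournament has low rank. *)
have [/existsP[i /existsP[j /andP[ij /eqP aij]]]|] :=
    boolP [exists i : 'I_m, exists j : 'I_m,
             (i <= j)%N && (key (x i) == key (y j))].
  have ltf (l : 'I_m.+1) : (i + l < n)%N.
    by have := ltn_ord l; have := ltn_ord j; lia.
  rewrite eq_card0 ?mul0n ?muln0 // => T; apply/negbTE; rewrite !inE -ltnNge.
  suff : (m <= \rank (tournament_matrix a T))%N by lia.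
  apply: (@rank_tournament_mx_constant _ _ _ _ _
    (fun l => s (Ordinal (ltf l))) (a (x i))) => //.
    by move=> l l' /s_inj[/addnI/val_inj].
  move=> l; apply: key_inj; apply/eqP; rewrite eqn_leq {1}aij.
  rewrite !s_mono //=; first lia.
  by have := ltn_ord l; lia.
rewrite negb_exists => /forallP key_neq.
apply: leq_trans
  (sum_expn_corank_tournament (a := a) (x := x) (y := y) _ _ _ _).
(* Markov's inequality: each low-rank tournament contributes at least [2 ^ k] to the sum. *)
- rewrite leq_mul2l /= -sum1_card big_distrl /= big_mkcond /=.
  apply: leq_sum => T _; case: ifP => // low; rewrite mul1n leq_exp2l //.
  by rewrite inE in low; lia.
- by move=> i j /s_inj[/val_inj].
- by move=> i j /s_inj[/addnI/val_inj].
- by move=> i j; apply/negP => /eqP/s_inj[]; have := ltn_ord i; lia.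
move=> i j ij; apply/negP => /eqP aij.
have := key_neq i; rewrite negb_exists => /forallP/(_ j).
by rewrite ij /key aij eqxx.
Qed.

Lemma card_tournament_gt0 (n : nat) : (0 < #|tournament n|)%N.
Proof.
apply/card_gt0P.
suff T0 : is_tournament [set p : 'I_n * 'I_n | (p.1 < p.2)%N].
  by exists (Sub _ T0).
apply/andP; split; apply/forallP => i; first by rewrite inE /= ltnn.
apply/forallP => j; apply/implyP => ij; rewrite !inE /=.
by case: ltngtP => // /val_inj /eqP; rewrite (negPf ij).
Qed.

(** * Numerical estimates and the limit *)

Lemma ln2_ge_half (R : realType) : 2^-1 <= ln 2 :> R.
Proof.
have := @le_ln1Dx R (- 2^-1); have -> : 1 - 2^-1 = 2^-1 :> R by lra.
by rewrite lnV ?posrE // lerN2; apply; lra.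
Qed.

Lemma up_log2_le_ln (R : realType) (n : nat) :
  (1 < n)%N -> (up_log 2 n)%:R <= 1 + 2 * ln n%:R :> R.
Proof.
move=> n1; have k_gt0 : (0 < up_log 2 n)%N by rewrite up_log_gt0.
have : (2 ^ (up_log 2 n).-1)%:R <= n%:R :> R.
  by rewrite ler_nat ltnW ?up_log_gtn.
rewrite natrX -ler_ln ?posrE ?exprn_gt0 ?ltr0n ?(ltnW n1) // lnXn //.
rewrite -[ln 2 *+ _]mulr_natl => h.
have -> : (up_log 2 n)%:R = (up_log 2 n).-1%:R + 1 :> R by rewrite natr1 prednK.
have := ler0n R (up_log 2 n).-1; have := ln2_ge_half R; nra.
Qed.

(** Twice the logarithm costs at most [2 + 4 * ln n] and rounding [n / 2] costs at most 1/2. Since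
    [ln n] is at most [sqrt (n * ln n)], which is itself at least 1/2, the term with constant 21
    covers both. *)
Lemma low_rank_tournament_tail (R : realType) (n r : nat) : (1 < n)%N ->
  ~~ (n%:R / 2 - 21 * Num.sqrt (n%:R * ln n%:R) <= r%:R :> R) ->
  (r + 2 * up_log 2 n <= n./2)%N.
Proof.
move=> n1; rewrite -ltNge => rlt.
have ln_half : 2^-1 <= ln n%:R :> R.
  rewrite (le_trans (ln2_ge_half R)) // ler_ln ?posrE ?ltr0n ?ler_nat //.
  exact: ltnW.
have ln_le : ln n%:R <= n%:R :> R.
  have := @le_ln1Dx R (n%:R - 1); rewrite addrCA subrr addr0 => h.
  by rewrite (le_trans (h _)) ?gerBl // ltrBrDr addNr ltr0n ltnW.
have sqrt_ge : ln n%:R <= Num.sqrt (n%:R * ln n%:R) :> R.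
  rewrite -[X in X <= _]ger0_norm -?sqrtr_sqr ?ler_sqrt; first nra; nra.
have half_ge : n%:R <= 2 * (n./2)%:R + 1 :> R.
  by rewrite -natrM -[X in _ <= _ + X]/(1%:R) -natrD ler_nat; lia.
have := up_log2_le_ln R n1.
by rewrite -ltnS -(ltr_nat R) natrD natrM -[X in _ < X]natr1; lra.
Qed.

Local Open Scope classical_set_scope.

Theorem theorem2 (R : realType) (F : fieldType) (a : nat -> F)
    (charF : 2%N \notin [pchar F]) (a_neq0 : forall k : nat, a k != 0) :
  tournament_prob R (fun T : tournament n =>
      n%:R / 2 - 21 * Num.sqrt (n%:R * ln n%:R)
        <= (\rank (tournament_matrix a T))%:R :> R) @[n --> \oo] --> (1 : R).
Proof.
(* The probability is squeezed between [1 - 1 / (n + 1)] and 1. *)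
have harm : (1 - harmonic n : R) @[n --> \oo] --> (1 : R).
  rewrite -[X in _ --> X]subr0; apply: cvgB; first exact: cvg_cst.
  exact: cvg_harmonic.
apply: (squeeze_cvgr _ harm (cvg_cst (1 : R))).
near=> n.
have n3 : (3 <= n)%N by near: n; exact: nbhs_infty_ge.
rewrite /tournament_prob /harmonic; set E := fun T : tournament n => _.
have tot0 : 0 < #|tournament n|%:R :> R by rewrite ltr0n card_tournament_gt0.
rewrite ler_pdivrMr // mul1r ler_nat max_card andbT ler_pdivlMr //.
rewrite -(cardC E) natrD.
(* Taking [k = 2 * up_log 2 n] gives [2 ^ k >= n ^ 2], against which the factor [n./2 + 2] leaves a
   failure probability of at most [1 / (n + 1)]. *)
have bad : (#|predC E| * n.+1 <= #|tournament n|)%N.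
  have k_gt0 : (0 < 2 * up_log 2 n)%N by rewrite muln_gt0 up_log_gt0; lia.
  have := card_low_rank_tournament a_neq0 n k_gt0.
  set low := [pred T : tournament n | _] => tot.
  have Elow : (#|predC E| <= #|low|)%N.
    apply/subset_leq_card/fintype.subsetP => T; rewrite !inE.
    by apply: low_rank_tournament_tail; lia.
  have nk : (n * n <= 2 ^ (2 * up_log 2 n))%N.
    by rewrite mul2n -addnn expnD leq_mul ?up_logP.
  have {tot} tot := leq_trans (leq_mul (leqnn 2) (leq_mul Elow nk)) tot.
  (* This inequality fails at [n = 2], hence the bound [n3]. *)
  have nn : (n./2.+2 * n.+1 <= 2 * (n * n))%N by nia.
  rewrite -(@leq_pmul2l (2 * (n * n))) ?muln_gt0 ?andbb ?(ltnW (ltnW n3)) //.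
  have := leq_mul tot (leqnn n.+1).
  have := leq_mul nn (leqnn #|tournament n|); lia.
move: bad; rewrite -(ler_nat R) natrM -(cardC E) natrD => bad.
rewrite mulrBl mul1r lerBlDr lerD2l mulrC ler_pdivlMr ?ltr0n //.
Unshelve. all: by end_near.
Qed.
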